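(* The Identity Correspondence Problem is undecidable, already over the binary group alphabet $\{a,b,a^{-1},b^{-1}\}$ and for instances consisting of $m=48$ pairs of words. More precisely, it is undecidable for $m=8(n-1)$ where $n$ is any number of pairs for which Restricted PCP is undecidable (e.g. $n=7$).
   Context: $F(\{a,b\})$ denotes the free group on $\{a,b\}$, whose elements are reduced words over $\{a,b,a^{-1},b^{-1}\}$; $\varepsilon$ denotes the empty word (identity). Identity Correspondence Problem (ICP): given a finite set $\Pi=\{(s_1,t_1),\ldots,(s_m,t_m)\}\subseteq F(\{a,b\})\times F(\{a,b\})$, decide whether there exists a nonempty finite sequence of indices $l_1,\ldots,l_k$ with $1\le l_i\le m$ such that $s_{l_1}s_{l_2}\cdots s_{l_k}=t_{l_1}t_{l_2}\cdots t_{l_k}=\varepsilon$. Restricted PCP: given $P=\{(u_1,v_1),\ldots,(u_n,v_n)\}\subseteq\{a,b\}^*\times\{a,b\}^*$ with $n\ge3$, decide whether there is a finite sequence $l_1,\ldots,l_k$ with $2\le l_i\le n-1$ such that $u_1u_{l_1}\cdots u_{l_k}u_n=v_1v_{l_1}\cdots v_{l_k}v_n$; this is known to be undecidable for $n=7$. *)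

(* Defs.v *)
From mathcomp Require Import all_boot.
Set Implicit Arguments. Unset Strict Implicit. Unset Printing Implicit Defensive.

Inductive rcode : Type :=
| RZero : rcode
| RSucc : rcode
| RProj : nat -> rcode
| RComp : rcode -> seq rcode -> rcode
| RPrim : rcode -> rcode -> rcode
| RMu   : rcode -> rcode.

Inductive reval : rcode -> seq nat -> nat -> Prop :=
| ev_zero v : reval RZero v 0
| ev_succ x v : reval RSucc (x :: v) x.+1
| ev_proj i v : i < size v -> reval (RProj i) v (nth 0 v i)
| ev_comp f gs v ws y :
    revals gs v ws -> reval f ws y -> reval (RComp f gs) v y
| ev_prim0 f g v y : reval f v y -> reval (RPrim f g) (0 :: v) y
| ev_primS f g n v r y :
    reval (RPrim f g) (n :: v) r -> reval g (n :: r :: v) y ->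
    reval (RPrim f g) (n.+1 :: v) y
| ev_mu f v n (k : nat -> nat) :
    reval f (n :: v) 0 ->
    (forall m, m < n -> reval f (m :: v) (k m).+1) ->
    reval (RMu f) v n
with revals : seq rcode -> seq nat -> seq nat -> Prop :=
| evs_nil v : revals [::] v [::]
| evs_cons g gs v y ys :
    reval g v y -> revals gs v ys -> revals (g :: gs) v (y :: ys).

Definition rec_decidable (A : nat -> Prop) : Prop :=
  exists c : rcode, forall x : nat,
    (A x -> reval c [:: x] 1) /\ (~ A x -> reval c [:: x] 0).

Definition decidable_problem (T : countType) (P : T -> Prop) : Prop :=
  rec_decidable (fun x => exists t : T, pickle t = x /\ P t).

Definition letter := (bool * bool)%type.
Definition ga : letter := (false, false).
Definition gb : letter := (true, false).
Definition ga_inv : letter := (false, true).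
Definition gb_inv : letter := (true, true).
Definition linv (x : letter) : letter := (x.1, ~~ x.2).

Definition fword := seq letter.

Definition freduced (w : fword) : bool :=
  all (fun p : letter * letter => p.2 != linv p.1) (zip w (behead w)).

Definition freduce (w : fword) : fword :=
  foldr (fun x acc => match acc with
                      | y :: r => if y == linv x then r else x :: acc
                      | [::] => [:: x]
                      end) [::] w.

Definition icp_instance := seq (fword * fword).

Definition ICP_solvable (Pi : icp_instance) : Prop :=
  exists ls : seq nat,
    ls != [::] /\ all (fun l => l < size Pi) ls /\
    freduce (flatten [seq (nth ([::], [::]) Pi l).1 | l <- ls]) = [::] /\
    freduce (flatten [seq (nth ([::], [::]) Pi l).2 | l <- ls]) = [::].

Definition ICP (m : nat) (Pi : icp_instance) : Prop :=
  size Pi = m /\ all (fun p => freduced p.1 && freduced p.2) Pi /\ ICP_solvable Pi.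

(* words over {a,b}: a = false, b = true *)
Definition pcp_instance := seq (seq bool * seq bool).

(* 0-based indices: first pair 0, last pair n-1, middle pairs 1 .. n-2 *)
Definition RPCP_solvable (P : pcp_instance) : Prop :=
  let n := size P in
  let u i := (nth ([::], [::]) P i).1 in
  let v i := (nth ([::], [::]) P i).2 in
  exists ls : seq nat,
    all (fun l => (0 < l) && (l < n.-1)) ls /\
    u 0 ++ flatten [seq u l | l <- ls] ++ u n.-1 =
    v 0 ++ flatten [seq v l | l <- ls] ++ v n.-1.

Definition RPCP (n : nat) (P : pcp_instance) : Prop :=
  size P = n /\ RPCP_solvable P.

(* Main.v *)
(* Idea.  Write u_i, v_i for the words of a Restricted PCP instance with pairs
   indexed by 0, ..., l.  Over free generators x_0, ..., x_3, t, s_1, s_2, ...,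
   consider the pairs
     A_i = (u_i, s_i),             B_i = (v_i^-1, t^-1 s_i^-1 t),
     T = (u_l v_l^-1, t),          D_k = (v_0^-1 x_(k-1)^-1 x_k u_0,
                                          t^-1 x_(k-1)^-1 x_k)   (k mod 4)
   with 0 < i < l.  For a block W = A_(i_1) ... A_(i_m) T B_(i_m) ... B_(i_1)
   coming from a solution, D_0 W D_1 W D_2 W D_3 W is the identity.

   Conversely, call the stretch between two successive D's good in one component
   if it has the form x_k c x_k^-1 with c trivial and free of x's.  In a trivial
   word with d > 0 occurrences of D, the noncrossing matching of cancelling
   letters shows that more than d/2 stretches are good: a cancelling pair
   x_k^-1 ... x_k has to enclose at least three pairs x_j ... x_j^-1, since the
   indices increase by one modulo 4 from one D to the next.  Hence some stretch is
   good in both components.  In the second component the exponent of t and the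
   number of s-letters at each t-height force this stretch to be a block W as
   above, and the first component then says that W is a solution.  A trivial
   product without D's is excluded by the same counts.

   Finally the generators are embedded in F(a,b) by e |-> a^e b a^-e, and the
   map between the codes of the instances is primitive recursive. *)
Require Import Defs.
From HB Require Import structures.
From mathcomp Require Import all_boot.
From mathcomp Require Import ssralg ssrint zify.
Set Implicit Arguments. Unset Strict Implicit. Unset Printing Implicit Defensive.

(** * Primitive recursive functions *)

(** The code has to be right only on vectors of length [k], so composite functions can be written
    freely with projections [nth 0 v i]. *)
Definition computable k (f : seq nat -> nat) :=
  exists c, forall v, size v = k -> reval c v (f v).

Notation computable1 f := (computable 1 (fun v => f (nth 0 v 0))).
Notation computable2 f := (computable 2 (fun v => f (nth 0 v 0) (nth 0 v 1))).
Notation computable3 f :=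
  (computable 3 (fun v => f (nth 0 v 0) (nth 0 v 1) (nth 0 v 2))).

Lemma eq_computable k f g : f =1 g -> computable k f -> computable k g.
Proof. by move=> fg [c cP]; exists c => v /cP; rewrite fg. Qed.

Lemma computable_nth k i : i < k -> computable k (fun v => nth 0 v i).
Proof. by move=> ik; exists (RProj i) => v vk; constructor; rewrite vk. Qed.

Lemma computable_comp1 k f a :
  computable1 f -> computable k a -> computable k (fun v => f (a v)).
Proof.
move=> [c cP] [d dP]; exists (RComp c [:: d]) => v vk.
by apply: (@ev_comp _ _ _ [:: a v]); [do !constructor; apply: dP | apply: cP].
Qed.

Lemma computable_comp2 k f a b :
  computable2 f -> computable k a -> computable k b ->
  computable k (fun v => f (a v) (b v)).
Proof.
move=> [c cP] [d dP] [e eP]; exists (RComp c [:: d; e]) => v vk.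
apply: (@ev_comp _ _ _ [:: a v; b v]); last by apply: cP.
by do !constructor; [apply: dP | apply: eP].
Qed.

Lemma computable_const k m : computable k (fun=> m).
Proof.
elim: m => [|m [c cP]]; first by exists RZero => v _; constructor.
exists (RComp RSucc [:: c]) => v vk.
by apply: (@ev_comp _ _ _ [:: m]); do !constructor; apply: cP.
Qed.

Lemma computable_succ : computable1 S.
Proof. by exists RSucc => [[|x v]] // _; constructor. Qed.

(** [h] receives the counter before the recursive value, the order in which [RPrim] passes them. *)
Fixpoint prec (z : nat) (h : nat -> nat -> nat) n :=
  if n is m.+1 then h m (prec z h m) else z.

Lemma computable_prec z h :
  computable1 z -> computable3 h ->
  computable2 (fun n x => prec (z x) (fun m r => h m r x) n).
Proof.
move=> [c cP] [d dP]; exists (RPrim c d) => [[|n [|x [|]]]] // _ /=.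
elim: n => [|n IHn] /=; first by constructor; apply: cP.
by apply: ev_primS IHn _; apply: dP.
Qed.

Ltac comp_nth := by apply: computable_nth.

Lemma computable_iter f : computable1 f -> computable2 (fun n x => iter n f x).
Proof.
move=> fP; apply: (@eq_computable _
  (fun v => prec (nth 0 v 1) (fun m r => f r) (nth 0 v 0))).
  by move=> v; elim: (nth 0 v 0) => //= n ->.
apply: (computable_prec (z := id) (h := fun _ r _ => f r)); first comp_nth.
by apply: computable_comp1 fP _; comp_nth.
Qed.

Lemma computable_pred : computable1 predn.
Proof.
apply: (@eq_computable _
  (fun v => prec ((fun=> 0) (nth 0 v 0)) (fun m _ => m) (nth 0 v 0))).
  by move=> v /=; case: (nth 0 v 0).
(* The recursion scheme carries one parameter; the single input serves both as counter and as
   parameter. *)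
apply: (@computable_comp2 1
  (fun n x => prec ((fun=> 0) x) (fun m r => (fun m _ _ => m) m r x) n)
  (nth 0 ^~ 0) (nth 0 ^~ 0)).
- apply: (computable_prec (z := fun=> 0) (h := fun m _ _ => m)).
    exact: computable_const.
  comp_nth.
- comp_nth.
- comp_nth.
Qed.

Lemma computable_add : computable2 addn.
Proof.
apply: (@eq_computable _ (fun v => iter (nth 0 v 0) S (nth 0 v 1))).
  by move=> v; elim: (nth 0 v 0) => //= n ->.
exact: computable_iter computable_succ.
Qed.

Lemma computable_sub : computable2 subn.
Proof.
apply: (@eq_computable _ (fun v => iter (nth 0 v 1) predn (nth 0 v 0))).
  by move=> v; elim: (nth 0 v 1) => [|n /= ->]; rewrite ?subn0 ?subnS.
by apply: (computable_comp2 (computable_iter computable_pred)); comp_nth.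
Qed.

Lemma computable_mul : computable2 muln.
Proof.
apply: (@eq_computable _
  (fun v => prec 0 (fun _ r => r + nth 0 v 1) (nth 0 v 0))).
  by move=> v; elim: (nth 0 v 0) => //= n ->; rewrite mulSn addnC.
apply: (@computable_prec (fun=> 0) (fun _ r x => r + x)).
  exact: computable_const.
by apply: (computable_comp2 computable_add); comp_nth.
Qed.

Lemma computable_exp2 : computable1 (expn 2).
Proof.
apply: (@eq_computable _ (fun v => iter (nth 0 v 0) (fun x => x + x) 1)).
  by move=> v; elim: (nth 0 v 0) => //= n ->; rewrite expnS mul2n addnn.
apply: (computable_comp2 (f := fun n x => iter n (fun x => x + x) x)).
- by apply: computable_iter; apply: (computable_comp2 computable_add); comp_nth.
- comp_nth.
- exact: computable_const.
Qed.

Lemma computable_if k (b : seq nat -> bool) f g :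
  computable k (fun v => b v) -> computable k f -> computable k g ->
  computable k (fun v => if b v then f v else g v).
Proof.
move=> bP fP gP; apply: (@eq_computable _
  (fun v => b v * f v + (1 - b v) * g v)).
  by move=> v; case: (b v); rewrite /= ?mul1n ?mul0n ?addn0.
apply: (computable_comp2 computable_add); apply: (computable_comp2 computable_mul) => //.
by apply: (computable_comp2 computable_sub) => //; apply: computable_const.
Qed.

Lemma computable_eq : computable2 (fun x y => x == y).
Proof.
apply: (@eq_computable _ (fun v => 1 - ((nth 0 v 0 - nth 0 v 1) +
   (nth 0 v 1 - nth 0 v 0)))).
  move=> v; rewrite eqn_leq -!subn_eq0 -addn_eq0.
  by case: (_ + _).
apply: (computable_comp2 computable_sub); first exact: computable_const.
apply: (computable_comp2 computable_add);
  by apply: (computable_comp2 computable_sub); comp_nth.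
Qed.

Lemma computable_odd : computable1 (fun n => odd n).
Proof.
apply: (@eq_computable _ (fun v => iter (nth 0 v 0) (fun x => 1 - x) 0)).
  by move=> v; elim: (nth 0 v 0) => //= n ->; case: (odd n).
apply: (computable_comp2 (f := fun n x => iter n (fun x => 1 - x) x)).
- apply: computable_iter; apply: (computable_comp2 computable_sub); last comp_nth.
  exact: computable_const.
- comp_nth.
- exact: computable_const.
Qed.

Lemma computable_half : computable1 half.
Proof.
(* With halves rounded down, the half of m + 1 is m minus the half of m. *)
apply: (@eq_computable _
  (fun v => prec ((fun=> 0) (nth 0 v 0)) (fun m r => m - r) (nth 0 v 0))).
  move=> v; elim: (nth 0 v 0) => //= n ->; rewrite uphalf_half.
  by rewrite -{1}[n]odd_double_half -addnn addnA addnK.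
apply: (@computable_comp2 1
  (fun n x => prec ((fun=> 0) x) (fun m r => (fun m r _ => m - r) m r x) n)
  (nth 0 ^~ 0) (nth 0 ^~ 0)).
- apply: (computable_prec (z := fun=> 0) (h := fun m r _ => m - r)).
    exact: computable_const.
  by apply: (computable_comp2 computable_sub); comp_nth.
- comp_nth.
- comp_nth.
Qed.

(** * Sequences coded by numbers *)

Notation code := CodeSeq.code.
(** This is the cons of [CodeSeq.code]: the head is the exponent of 2, and the odd part carries the
    tail. *)
Definition ccons a s := 2 ^ a * s.*2.+1.
Definition odd_part_step m := if odd m || (m == 0) then m else m./2.
(** Halving [m] times is enough to reach the odd part, since a code exceeds its head
    ([ltn_ccons]). *)
Definition ctail m := (iter m odd_part_step m)./2.
(** The exponent of 2 is the number of even values met during the repeated halving. *)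
Definition chead m :=
  prec 0 (fun i r => r + (1 - odd (iter i odd_part_step m))) m.

Lemma iter_odd_part a s i :
  iter i odd_part_step (ccons a s) = ccons (a - i) s.
Proof.
elim: i => [|i /= ->]; first by rewrite subn0.
rewrite subnS /odd_part_step /ccons muln_eq0 expn_eq0 /= orbF.
case: (a - i) => [|j]; first by rewrite expn0 mul1n oddS odd_double.
by rewrite expnS -mulnA mul2n odd_double doubleK.
Qed.

Lemma ltn_ccons a s : a < ccons a s.
Proof. by apply: leq_trans (ltn_expl a _) (leq_pmulr _ _). Qed.

Lemma ctailK a s : ctail (ccons a s) = s.
Proof.
rewrite /ctail iter_odd_part.
have /eqP-> : a - ccons a s == 0 by rewrite subn_eq0 ltnW // ltn_ccons.
by rewrite /ccons mul1n /= uphalf_double.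
Qed.

Lemma cheadK a s : chead (ccons a s) = a.
Proof.
rewrite /chead.
have E i : prec 0 (fun i r => r + (1 - odd (iter i odd_part_step (ccons a s)))) i
  = minn i a.
  elim: i => [|i /= ->]; first by rewrite min0n.
  rewrite iter_odd_part /ccons oddM /= odd_double andbT.
  have [ai|ia] := leqP a i.
    have /eqP -> : a - i == 0 by rewrite subn_eq0.
    by rewrite (minn_idPr (leqW ai)) expn0 subnn addn0.
  rewrite (minn_idPl ia); move: ia; rewrite -subn_gt0.
  by case: (a - i) => // j _; rewrite expnS oddM /= addn1.
by rewrite E; apply/minn_idPr/ltnW/ltn_ccons.
Qed.

Lemma computable_cons : computable2 ccons.
Proof.
apply: (computable_comp2 computable_mul).
  by apply: (computable_comp1 computable_exp2); comp_nth.
apply: (computable_comp1 computable_succ).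
apply: (@eq_computable _ (fun v => nth 0 v 1 + nth 0 v 1)).
  by move=> v; rewrite addnn.
by apply: (computable_comp2 computable_add); comp_nth.
Qed.

Lemma computable_odd_part_step : computable1 odd_part_step.
Proof.
apply: (@eq_computable _ (fun v => if odd (nth 0 v 0) then nth 0 v 0 else
   (nth 0 v 0)./2)).
  by move=> v; rewrite /odd_part_step; case: (odd _) => //=; case: eqP => // ->.
apply: computable_if; [exact: computable_odd | comp_nth | exact: computable_half].
Qed.

Lemma computable_tail : computable1 ctail.
Proof.
apply: (computable_comp1 computable_half).
by apply: (computable_comp2 (computable_iter computable_odd_part_step)); comp_nth.
Qed.

Lemma computable_head : computable1 chead.
Proof.
apply: (@computable_comp2 1
  (fun n x => prec ((fun=> 0) x)
     (fun m r => (fun m r x => r + (1 - odd (iter m odd_part_step x))) m r x) n)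
  (nth 0 ^~ 0) (nth 0 ^~ 0)).
- apply: (computable_prec (z := fun=> 0)
    (h := fun m r x => r + (1 - odd (iter m odd_part_step x)))).
    exact: computable_const.
  apply: (computable_comp2 computable_add); first comp_nth.
  apply: (computable_comp2 computable_sub); first exact: computable_const.
  apply: (computable_comp1 (f := fun x => odd x) computable_odd).
  by apply: (computable_comp2 (computable_iter computable_odd_part_step)); comp_nth.
- comp_nth.
- comp_nth.
Qed.

Lemma code_cons a s : code (a :: s) = ccons a (code s).
Proof. by []. Qed.

Lemma leq_size_code s : size s <= code s.
Proof.
elim: s => //= a s IHs; apply: leq_trans (leq_pmull _ _); last by rewrite expn_gt0.
by rewrite ltnS (leq_trans IHs) // -addnn leq_addr.
Qed.

(** * Folds over coded sequences *)

Section Fold.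
Variable h : nat -> nat -> nat.
Hypothesis hP : computable2 h.

(** The state is one coded sequence: the accumulator is its head and the entries still to be read
    form its tail. *)
Definition cfoldl_step s :=
  if ctail s == 0 then s
  else ccons (h (chead s) (chead (ctail s))) (ctail (ctail s)).
Definition cfoldl z l := chead (iter l cfoldl_step (ccons z l)).

(** The code of [s] serves as the number of iterations: it bounds the length, and the step is
    stationary once all entries are read. *)
Lemma cfoldlE z s : cfoldl z (code s) = foldl h z s.
Proof.
rewrite /cfoldl; have: size s <= code s by exact: leq_size_code.
elim: s {1 2}(code s) z => [|a s IHs] m z.
  move=> _; have E : cfoldl_step (ccons z 0) = ccons z 0.
    by rewrite /cfoldl_step ctailK.
  suff -> : iter m cfoldl_step (ccons z 0) = ccons z 0 by rewrite cheadK.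
  by elim: m => //= m ->.
case: m => // m ms; rewrite iterSr {2}/cfoldl_step ctailK code_cons.
rewrite -[_ == 0]negbK -lt0n (leq_trans _ (ltn_ccons _ _)) //=.
by rewrite !cheadK ctailK IHs.
Qed.

Lemma computable_foldl : computable2 cfoldl.
Proof.
apply: (computable_comp1 computable_head).
have fP : computable1 cfoldl_step.
  apply: computable_if.
  - apply: (computable_comp2 (f := fun x y => x == y) computable_eq); last exact: computable_const.
    exact: computable_tail.
  - comp_nth.
  - apply: (computable_comp2 computable_cons).
      apply: (computable_comp2 hP); first exact: computable_head.
      by apply: (computable_comp1 computable_head); apply: computable_tail.
    by apply: (computable_comp1 computable_tail); apply: computable_tail.
apply: (computable_comp2 (computable_iter fP)); first comp_nth.
by apply: (computable_comp2 computable_cons); comp_nth.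
Qed.
End Fold.

Definition crev := cfoldl (fun s a => ccons a s) 0.

Lemma crevE s : crev (code s) = code (rev s).
Proof.
rewrite /crev cfoldlE /rev -[0]/(code [::]).
by elim: s [::] => //= a s IHs t; rewrite -code_cons IHs.
Qed.

Lemma computable_rev : computable1 crev.
Proof.
apply: (@computable_comp2 1 (cfoldl (fun s a => ccons a s)) (fun=> 0)).
- by apply: computable_foldl; apply: (computable_comp2 computable_cons); comp_nth.
- exact: computable_const.
- comp_nth.
Qed.

Definition cfoldr h z l := cfoldl (fun z x => h x z) z (crev l).

Lemma cfoldrE h z s : cfoldr h z (code s) = foldr h z s.
Proof. by rewrite /cfoldr crevE cfoldlE foldl_rev. Qed.

Lemma computable_foldr h : computable2 h -> computable2 (cfoldr h).
Proof.
move=> hP; apply: (computable_comp2 (f := cfoldl (fun z x => h x z))).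
- by apply: computable_foldl; apply: (computable_comp2 hP); comp_nth.
- comp_nth.
- by apply: (computable_comp1 computable_rev); comp_nth.
Qed.

(** * Free groups and Dyck words *)

Section FreeGroup.
Variable E : eqType.
Notation L := (E * bool)%type.

Definition inv_letter (x : L) : L := (x.1, ~~ x.2).
Definition inv_word (w : seq L) := rev (map inv_letter w).
(** The left action of a letter on reduced words; working with it avoids a quotient construction of
    the free group. *)
Definition act (x : L) (s : seq L) :=
  if s is y :: r then if y == inv_letter x then r else x :: s else [:: x].
Fixpoint is_reduced (s : seq L) :=
  if s is x :: r then
    (if r is y :: _ then y != inv_letter x else true) && is_reduced r
  else true.

Lemma inv_letterK : involutive inv_letter.
Proof. by case=> e b; rewrite /inv_letter /= negbK. Qed.

Lemma act_reduced x s : is_reduced s -> is_reduced (act x s).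
Proof.
by case: s => //= y r; case: ifP => [_ /andP[] //|yx] /=; rewrite yx.
Qed.

Lemma foldr_act_reduced w s : is_reduced s -> is_reduced (foldr act s w).
Proof. by move=> rs; elim: w => //= x w; apply: act_reduced. Qed.

Lemma actK x s : is_reduced s -> act x (act (inv_letter x) s) = s.
Proof.
case: s => [|y r] /=; first by rewrite eqxx.
rewrite inv_letterK; case: eqP => [->|_] /=; last by rewrite eqxx.
by case: r => //= z r /andP[/negbTE->].
Qed.

Definition trivial_word w := forall s, is_reduced s -> foldr act s w = s.

(** Words with a noncrossing matching of mutually inverse letters. They are the words equal to 1 in
    the free group ([dyck_trivial], [trivial_word_dyck]), and induction on them exposes the nesting
    of cancellations. *)
Inductive dyck : seq L -> Prop :=
| dyck_nil : dyck [::]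
| dyck_cons x w1 w2 :
    dyck w1 -> dyck w2 -> dyck (x :: w1 ++ inv_letter x :: w2).

Lemma dyck_trivial w : dyck w -> trivial_word w.
Proof.
elim=> [|x w1 w2 _ IH1 _ IH2] s rs //=.
rewrite foldr_cat /= IH2 // IH1 ?actK //; exact: act_reduced.
Qed.

Lemma dyck_cat w w' : dyck w -> dyck w' -> dyck (w ++ w').
Proof.
move=> dw dw'; elim: dw => //= x w1 w2 d1 _ _ d2.
by rewrite -catA; apply: dyck_cons.
Qed.

Lemma dyck_conj x w : dyck w -> dyck (x :: w ++ [:: inv_letter x]).
Proof. by move=> dw; apply: dyck_cons => //; apply: dyck_nil. Qed.

Lemma dyck_conj_word c w : dyck w -> dyck (c ++ w ++ inv_word c).
Proof.
elim: c w => [|x c IHc] w dw; first by rewrite cats0.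
rewrite /inv_word /= rev_cons -cats1 catA catA -[_ ++ inv_word c]catA.
by apply: (dyck_conj x); apply: IHc.
Qed.

(** The relation of arising from [s] by inserting Dyck words around its letters, that is, by undoing
    cancellations. *)
Fixpoint dyck_over (s w : seq L) : Prop :=
  if s is x :: r then
    exists d w', [/\ w = d ++ x :: w', dyck d & dyck_over r w']
  else dyck w.

Lemma dyck_over_cat s d w : dyck d -> dyck_over s w -> dyck_over s (d ++ w).
Proof.
case: s => /= [|x r] dd; first exact: dyck_cat.
move=> [d' [w' [-> dd' ow']]]; exists (d ++ d'), w'; split=> //.
  by rewrite catA.
exact: dyck_cat.
Qed.

Lemma dyck_over_foldr w : dyck_over (foldr act [::] w) w.
Proof.
elim: w => [|x w IHw] /=; first exact: dyck_nil.
case: (foldr act [::] w) IHw => [|y r] /=.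
  by move=> dw; exists [::], w; split=> //; apply: dyck_nil.
(* If x cancels y, then x d y is a Dyck word and joins the insertion in front of [r]. *)
move=> [d [w' [-> dd ow']]]; case: eqP => [->|_] /=.
  rewrite -cat1s -cat_rcons catA -cat1s; rewrite cat1s.
  apply: dyck_over_cat ow'; rewrite -cats1; exact: dyck_conj.
exists [::], (d ++ y :: w'); split=> //; first exact: dyck_nil.
by exists d, w'.
Qed.

Lemma trivial_word_dyck w : trivial_word w -> dyck w.
Proof. by move=> tw; have := dyck_over_foldr w; rewrite tw. Qed.

Lemma inv_word_trivial w s : is_reduced s ->
  foldr act (foldr act s w) (inv_word w) = s.
Proof.
elim: w s => //= x w IHw s rs.
rewrite /inv_word /= rev_cons -cats1 foldr_cat /=.
have := actK (inv_letter x) (foldr_act_reduced w rs).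
by rewrite inv_letterK => ->; apply: IHw.
Qed.

(** The word q p is the conjugate of p q by the inverse of p. *)
Lemma trivial_rot p q : trivial_word (p ++ q) -> trivial_word (q ++ p).
Proof.
move=> tpq s rs; rewrite foldr_cat; set s' := foldr act s p.
have rs' : is_reduced s' by apply: foldr_act_reduced.
rewrite -[LHS](inv_word_trivial p); last exact: foldr_act_reduced.
by rewrite -[foldr act (foldr act s' q) p]foldr_cat tpq // inv_word_trivial.
Qed.

Lemma dyck_count (p : pred E) w : dyck w ->
  count (fun x => p x.1 && x.2) w = count (fun x => p x.1 && ~~ x.2) w.
Proof.
elim=> //= x w1 w2 _ E1 _ E2; rewrite !count_cat /= E1 E2.
by case: x => f [] /=; case: (p f); lia.
Qed.

Definition posw (s : seq E) : seq L := [seq (e, false) | e <- s].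

Lemma posw_reduced s : is_reduced (posw s).
Proof. by elim: s => //= e [|f s] //= ->; rewrite xpair_eqE andbF. Qed.

Lemma foldr_act_posw s t : foldr act (posw t) (posw s) = posw (s ++ t).
Proof.
elim: s => //= e s ->; case: (s ++ t) => //= f r.
by rewrite xpair_eqE andbF.
Qed.

(** Let the word act on [posw t]: the inverse factor erases it, and the positive factor then writes
    [posw s] without any cancellation. *)
Lemma dyck_pos_inv s t : dyck (posw s ++ inv_word (posw t)) -> s = t.
Proof.
move=> /dyck_trivial /(_ _ (posw_reduced t)).
rewrite foldr_cat -{1}[t]cats0 -foldr_act_posw inv_word_trivial //.
rewrite foldr_act_posw cats0.
by apply: inj_map => x y [].
Qed.

Lemma dyck_inv_refl w : dyck (w ++ inv_word w).
Proof. by have := dyck_conj_word w dyck_nil; rewrite cat0s. Qed.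

End FreeGroup.

Lemma dyck_map (E F : eqType) (f : E -> F) (w : seq (E * bool)) :
  dyck w -> dyck [seq (f x.1, x.2) | x <- w].
Proof.
elim=> [|x w1 w2 _ d1 _ d2] /=; first exact: dyck_nil.
by rewrite map_cat /=; apply: (dyck_cons (f x.1, x.2)).
Qed.

(** * Heights *)

Section Height.
Variables (E : eqType) (t : E).
Local Open Scope ring_scope.
Import GRing.Theory.
Notation L := (E * bool)%type.

Definition letter_height (x : L) : int :=
  if x.1 == t then (if x.2 then -1 else 1) else 0.
Fixpoint height (w : seq L) : int :=
  if w is x :: r then letter_height x + height r else 0.
(** A letter e at height h stands for the conjugate of e by the h-th power of t. This rewrites a
    word of height 0 in the free generators of the normal closure of the letters other than t. *)
Fixpoint hlift (h : int) (w : seq L) : seq ((int * E) * bool) :=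
  if w is x :: r then
    if x.1 == t then hlift (h + letter_height x) r
    else ((h, x.1), x.2) :: hlift h r
  else [::].

Lemma height_cat w1 w2 : height (w1 ++ w2) = height w1 + height w2.
Proof. by elim: w1 => [|x w1 /= ->]; rewrite ?add0r ?addrA. Qed.

Lemma hlift_cat h w1 w2 : hlift h (w1 ++ w2) = hlift h w1 ++ hlift (h + height w1) w2.
Proof.
elim: w1 h => [|x w1 IHw] h /=; first by rewrite addr0.
by rewrite !IHw addrA; case: eqP => // /eqP/negbTE xt; rewrite /letter_height xt addr0.
Qed.

Lemma letter_height_inv x : letter_height (inv_letter x) = - letter_height x.
Proof. by rewrite /letter_height; case: x => e [] /=; case: eqP; rewrite ?opprK ?oppr0. Qed.

Lemma dyck_height w : dyck w -> height w = 0.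
Proof.
elim=> //= x w1 w2 _ E1 _ E2; rewrite height_cat /= E1 E2 letter_height_inv.
by rewrite add0r addr0 subrr.
Qed.

(** The word enclosed by a cancelling pair has height 0, so both letters of the pair get the same
    label. *)
Lemma dyck_hlift h w : dyck w -> dyck (hlift h w).
Proof.
move=> dw; elim: dw h => [|x w1 w2 d1 IH1 _ IH2] h /=; first exact: dyck_nil.
rewrite !hlift_cat /= (dyck_height d1) letter_height_inv !addr0.
case: eqP => [_|xt]; first by rewrite addrK; apply: dyck_cat.
exact: (dyck_cons ((h, x.1), x.2)).
Qed.
End Height.

(** * Embedding of a free group of countable rank in F(a,b) *)

Lemma freduceE w : freduce w = foldr (@act bool) [::] w.
Proof. by []. Qed.

Lemma freduced_is_reduced w : freduced w = is_reduced w.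
Proof.
elim: w => //= x [|y w] //= <-.
by [].
Qed.

Definition emb (x : nat * bool) : fword :=
  nseq x.1 ga ++ (true, x.2) :: nseq x.1 ga_inv.
Definition embw w : fword := flatten [seq emb x | x <- w].

Lemma embw_cat w1 w2 : embw (w1 ++ w2) = embw w1 ++ embw w2.
Proof. by rewrite /embw map_cat flatten_cat. Qed.

Lemma emb_inv x : emb (inv_letter x) = inv_word (emb x).
Proof.
rewrite /inv_word /emb /= map_cat /= rev_cat rev_cons !map_nseq.
by rewrite !rev_nseq -cats1 -catA.
Qed.

Lemma dyck_embw w : dyck w -> dyck (embw w).
Proof.
elim=> [|x w1 w2 _ d1 _ d2]; first exact: dyck_nil.
rewrite -cat1s embw_cat embw_cat -[_ :: w2]cat1s embw_cat /embw /= !cats0 emb_inv.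
rewrite !catA -[X in X ++ _]catA; apply: dyck_cat => //; exact: dyck_conj_word.
Qed.

Section EmbeddingInjective.
Local Open Scope ring_scope.
Import GRing.Theory.

Lemma hlift_ga h e w : hlift false h (nseq e ga ++ w) = hlift false (h + e%:Z) w.
Proof.
elim: e h => [|e IHe] h /=; first by rewrite addr0.
by rewrite IHe /letter_height /= -addrA.
Qed.

Lemma hlift_ga_inv h e w :
  hlift false h (nseq e ga_inv ++ w) = hlift false (h - e%:Z) w.
Proof.
elim: e h => [|e IHe] h /=; first by rewrite subr0.
by rewrite IHe /letter_height /= -addrA; congr hlift; lia.
Qed.

Lemma hlift_embw w :
  hlift false 0 (embw w) = [seq ((x.1%:Z, true), x.2) | x <- w].
Proof.
elim: w => //= -[e b] w IHw; rewrite /embw /= -/(embw w) /emb -catA /=.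
by rewrite hlift_ga /= hlift_ga_inv add0r subrr IHw.
Qed.

(** Heights with respect to [a] recover [w]: every block starts and ends at height 0, and its [b]
    sits at the height of the encoded generator. *)
Lemma embw_dyck w : dyck (embw w) -> dyck w.
Proof.
move=> /(dyck_hlift false 0); rewrite hlift_embw.
move=> /(dyck_map (fun p : int * bool => `|p.1|%N)); rewrite -map_comp.
by rewrite (eq_map (g := id)) ?map_id // => -[].
Qed.
End EmbeddingInjective.

(** * Gaps between markers *)

Definition is_marker (x : nat * bool) := x.1 < 4.
Notation unmarked := (all (fun x => ~~ is_marker x)).
(** Here [w] is what follows a letter x_k, and [find] locates the next marker. The default
    [(4, false)] differs from every [(k, true)], so a stretch without a next marker is no gap. *)
Definition is_gap k (w : seq (nat * bool)) :=
  let i := find is_marker w in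
  (foldr (@act nat) [::] (take i w) == [::]) && (nth (4, false) w i == (k, true)).
Fixpoint good_gaps w :=
  if w is x :: r then [&& is_marker x, ~~ x.2 & is_gap x.1 r] + good_gaps r else 0.
(** In a word spelled by steps this is the number of D's, since each D contributes one inverse
    marker letter. *)
Definition closings := count (fun x : nat * bool => is_marker x && x.2).

Lemma is_gapI c k r : unmarked c -> k < 4 -> dyck c -> is_gap k (c ++ (k, true) :: r).
Proof.
move=> uc k4 /dyck_trivial tc; rewrite /is_gap find_cat.
have -> : has is_marker c = false by apply/negbTE; rewrite -all_predC.
rewrite /= {1 3}/is_marker k4 addn0 take_size_cat // tc // eqxx.
by rewrite nth_cat ltnn subnn /= eqxx.
Qed.

Lemma is_gapE c k x r : unmarked c -> is_marker x ->
  is_gap k (c ++ x :: r) -> dyck c /\ x = (k, true).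
Proof.
move=> uc mx; rewrite /is_gap find_cat.
have -> : has is_marker c = false by apply/negbTE; rewrite -all_predC.
rewrite /= mx addn0 take_size_cat // nth_cat ltnn subnn /=.
case/andP=> /eqP tc /eqP ->; split=> //.
by have := dyck_over_foldr c; rewrite tc.
Qed.

Lemma is_gap_unmarked k w : k < 4 -> unmarked w -> ~~ is_gap k w.
Proof.
move=> k4 uw; rewrite /is_gap.
have : has is_marker w = false by apply/negbTE; rewrite -all_predC.
rewrite has_find => /negbT; rewrite -leqNgt => sw.
rewrite negb_and (nth_default _ sw) orbC xpair_eqE andbF.
by [].
Qed.

Lemma is_gap_cat k w w' : is_gap k w -> is_gap k (w ++ w').
Proof.
rewrite /is_gap; set i := find _ w => /andP[ti /eqP ni].
have iw : i < size w.
  by rewrite ltnNge; apply/negP => /(nth_default (4, false)); rewrite ni.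
rewrite find_cat has_find iw -/i take_cat nth_cat iw ti ni.
exact: eqxx.
Qed.

(** Appending preserves the gaps of [w]; it may also complete a stretch left open at the end of
    [w]. *)
Lemma leq_good_gaps_cat w w' :
  good_gaps w + good_gaps w' <= good_gaps (w ++ w').
Proof.
elim: w => //= x w IHw; rewrite -addnA leq_add //.
by case: is_marker; case: x.2 => //=; case gx: is_gap => //; rewrite is_gap_cat.
Qed.

Lemma good_gaps_unmarked c w : unmarked c -> good_gaps (c ++ w) = good_gaps w.
Proof. by elim: c => //= x c IHc /andP[/negbTE-> /IHc]. Qed.

Lemma closings_cat w w' : closings (w ++ w') = closings w + closings w'.
Proof. exact: count_cat. Qed.

Lemma closings_unmarked c : unmarked c -> closings c = 0.
Proof. by elim: c => //= x c IHc /andP[/negbTE-> /IHc]. Qed.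

(* A state [Some k] means that x_k has to be read next, just after x_(k-1)^-1. *)
Definition step_state (s : option nat) (x : nat * bool) : option (option nat) :=
  if s is Some k then (if x == (k, false) then Some None else None)
  else if is_marker x then (if x.2 then Some (Some (x.1.+1 %% 4)) else None)
  else Some None.
Fixpoint run s w : option (option nat) :=
  if w is x :: r then obind (run ^~ r) (step_state s x) else Some s.

Lemma run_cat s w1 w2 : run s (w1 ++ w2) = obind (run ^~ w2) (run s w1).
Proof. by elim: w1 s => //= x w1 IH s; case: step_state. Qed.

(** Induction on the matching. A Dyck word read from state k splits at top level into m pairs x_j
    ... x_j^-1 with consecutive indices modulo 4, and each pair raises twice the gaps minus the
    closings by at least 1. A pair x_k^-1 ... x_k encloses such a word with m at least 3; its own
    closing letter costs 1, which leaves a surplus of 2. *)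
Lemma dyck_run w : dyck w ->
  (forall s', run None w = Some s' ->
     s' = None /\ (unmarked w \/ closings w + 2 <= 2 * good_gaps w)) /\
  (forall k s', k < 4 -> run (Some k) w = Some s' ->
     exists2 m, s' = Some ((k + m) %% 4) & closings w + m <= 2 * good_gaps w).
Proof.
elim=> [|x w1 w2 d1 [IH1 IHk1] d2 [IH2 IHk2]].
  split=> [s' [<-]|k s' k4 [<-]]; first by split=> //; left.
  by exists 0; rewrite ?addn0 ?modn_small.
have Gg := leq_good_gaps_cat w1 (inv_letter x :: w2).
have Gc : closings (w1 ++ inv_letter x :: w2) =
  closings w1 + ((is_marker x && ~~ x.2) + closings w2) by rewrite closings_cat.
split=> [s'|k s' k4] /=; last first.
  case: eqP => //= E; rewrite run_cat {}E in Gg Gc *.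
  case E1: (run None w1) => [s1|] //=.
  have [-> H1] := IH1 _ E1.
  rewrite /= {1}/is_marker /= k4 /=.
  move=> /IHk2 [|m -> H2]; first by rewrite ltn_mod.
  exists m.+1; first by rewrite modnDml addSnnS.
  rewrite /= in Gg; move: Gc; rewrite /= /is_marker /= k4 /= => ->.
  (* If [w1] is unmarked, the pair around it is itself a good gap. Otherwise the surplus 2 of [w1]
     pays for the closing letter and leaves 1. *)
  case: H1 => [u1|H1].
    have := is_gapI w2 u1 k4 d1 => ->; rewrite good_gaps_unmarked //=.
    by rewrite closings_unmarked // /is_marker /= k4 /=; lia.
  by move: Gg; rewrite /= /is_marker /= k4 /=; lia.
case: ifP => mx /=; last first.
  rewrite run_cat.
  case E1: (run None w1) => [s1|] //=.
  have [-> H1] := IH1 _ E1.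
  rewrite /= {1}/is_marker /= -/(is_marker x) mx /= => /IH2 [-> H2].
  split=> //; rewrite all_cat /= -/(is_marker x) /is_marker /= -/(is_marker x) mx /=.
  rewrite mx /= in Gc; rewrite Gc.
  move: Gg; rewrite /= /is_marker /= -/(is_marker x) mx /= => Gg.
  case: H1 => [u1|H1].
    case: H2 => [u2|H2]; first by left; rewrite u1.
    by right; rewrite closings_unmarked //; lia.
  right; case: H2 => [u2|H2]; last by lia.
  by rewrite (closings_unmarked u2); lia.
case x2: x.2 => //=; rewrite run_cat; case E1: (run _ w1) => [s1|] //=.
have [|m E H1] := IHk1 _ _ _ E1; first by rewrite ltn_mod.
rewrite {}E /= /inv_letter x2 /=; case: eqP => //= -[Em] /IH2 [-> H2]; split=> //; right.
rewrite mx x2 /inv_letter x2 /= in Gc; rewrite Gc.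
move: Gg; rewrite /= /inv_letter x2 /= => Gg.
(* The run of [w1] starts in state k + 1 and has to end in state k, so m is 3 modulo 4. *)
have m3 : 3 <= m.
  move: mx Em; rewrite /is_marker modnDml; lia.
case: H2 => [u2|H2]; last by lia.
by rewrite (closings_unmarked u2); lia.
Qed.

(** * Words spelled by sequences of marked steps *)

Section MarkedSteps.
Variables (S : Type) (mk : S -> option 'I_4).

Definition concat_words (wd : S -> seq (nat * bool)) es := flatten (map wd es).

Section OneWord.
Variables (wd : S -> seq (nat * bool)) (pre post : seq (nat * bool)).
Hypotheses (unmarked_pre : unmarked pre) (unmarked_post : unmarked post).
Hypothesis wdP : forall s,
  if mk s is Some k then
    wd s = pre ++ [:: ((k + 3) %% 4, true), (nat_of_ord k, false) & post]
  else unmarked (wd s).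

(** Gaps are attributed to the steps that open them, so that the gaps of the two components can be
    compared. *)
Fixpoint step_gaps es : nat :=
  if es is s :: r then
    (if mk s is Some k then is_gap k (post ++ concat_words wd r) else false)
    + step_gaps r
  else 0.

Lemma good_gaps_word es : good_gaps (concat_words wd es) = step_gaps es.
Proof.
rewrite /concat_words; elim: es => //= s es <-; have := wdP s.
case: (mk s) => [k ->|us]; last by rewrite good_gaps_unmarked.
rewrite -catA good_gaps_unmarked //= andbF /is_marker /= ltn_ord.
by rewrite good_gaps_unmarked.
Qed.

Lemma closings_word es : closings (concat_words wd es) = count (fun s => mk s) es.
Proof.
rewrite /concat_words; elim: es => //= s es IHes.
rewrite closings_cat IHes; congr (_ + _); have := wdP s.
case: (mk s) => [k ->|us]; last exact: closings_unmarked.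
rewrite closings_cat (closings_unmarked unmarked_pre) /=.
have := closings_unmarked unmarked_post; rewrite /closings => ->.
by rewrite /is_marker /= ltn_mod andbF.
Qed.

Lemma run_unmarked c w : unmarked c -> run None (c ++ w) = run None w.
Proof. by elim: c => //= x c IHc /andP[/negbTE -> /IHc]. Qed.

Lemma run_word es : run None (concat_words wd es) = Some None.
Proof.
rewrite /concat_words; elim: es => //= s es IHes; have := wdP s.
case: (mk s) => [k ->|us]; last by rewrite run_unmarked.
rewrite -catA run_unmarked //= /is_marker /= ltn_mod /=.
have -> : ((k + 3) %% 4).+1 %% 4 = k.
  by rewrite -addn1 modnDml -addnA addnC modnDl modn_small.
by rewrite eqxx /= run_unmarked.
Qed.

Lemma dyck_step_gaps es : has (fun s => mk s) es -> dyck (concat_words wd es) ->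
  count (fun s => mk s) es + 2 <= 2 * step_gaps es.
Proof.
move=> mes /dyck_run[/(_ _ (run_word es)) [_ H] _].
move: H; rewrite closings_word good_gaps_word => -[|//].
move/closings_unmarked; rewrite closings_word => c0.
by move: mes; rewrite has_count c0.
Qed.

Lemma gap_block k r : k < 4 -> is_gap k (post ++ concat_words wd r) ->
  dyck (post ++ concat_words wd (take (find (fun s => mk s) r) r) ++ pre).
Proof.
(* The prefix is generalised to any unmarked word, which absorbs the unmarked steps one at a time
   until the next marked step. *)
move=> k4; elim: r post unmarked_post => [|s r IHr] c uc.
  by rewrite /concat_words cats0 (negbTE (is_gap_unmarked k4 uc)).
rewrite /concat_words /=; have := wdP s.
case: (mk s) => [j ->|us] /=.
  rewrite -!catA catA => /is_gapE[]; last by move=> ? _.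
    by rewrite all_cat uc.
  by rewrite /is_marker /= ltn_mod.
rewrite catA => /IHr; rewrite all_cat uc us => /(_ isT).
by rewrite -!catA.
Qed.
End OneWord.

(** Pigeonhole: if no marked step opened a gap in both components, each would contribute at most 1
    to the sum. *)
Lemma common_gap (wd1 wd2 : S -> seq (nat * bool)) post1 post2 es :
  count (fun s => mk s) es < step_gaps wd1 post1 es + step_gaps wd2 post2 es ->
  exists es1 s r k, [/\ es = es1 ++ s :: r, mk s = Some k,
    is_gap k (post1 ++ concat_words wd1 r) & is_gap k (post2 ++ concat_words wd2 r)].
Proof.
elim: es => //= s es IHes H.
case mks: (mk s) H => [k|] /= H.
  case g: (is_gap k (post1 ++ concat_words wd1 es) &&
           is_gap k (post2 ++ concat_words wd2 es)).
    by case/andP: g => *; exists [::], s, es, k.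
  have {H g} : count (fun s => mk s) es <
      step_gaps wd1 post1 es + step_gaps wd2 post2 es.
    by move: g H; do 2!case: is_gap => //=; lia.
  by move=> /IHes[es1 [t [r [j [-> ? ? ?]]]]]; exists (s :: es1), t, r, j.
by move: H => /IHes[es1 [t [r [j [-> ? ? ?]]]]]; exists (s :: es1), t, r, j.
Qed.
End MarkedSteps.

(** * The generating pairs *)

(* Generators are numbered: x_k is [k] for [k < 4]; in the second component t is
   [4] and s_i is [5 + i], in the first one the letters a, b are [4], [5]. *)
Inductive step := SA of nat | SB of nat | ST | SD of 'I_4.

Definition step_marker s := if s is SD k then Some k else None.
Definition is_A s := if s is SA _ then true else false.
Definition is_B s := if s is SB _ then true else false.
Definition is_T s := if s is ST then true else false.
Definition is_AB s := is_A s || is_B s.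
Definition step_ok l s :=
  match s with SA i | SB i => 0 < i < l | _ => true end.

Definition marker_pair (k : 'I_4) : seq (nat * bool) :=
  [:: ((k + 3) %% 4, true); (nat_of_ord k, false)].

Definition index_word s : seq (nat * bool) :=
  match s with
  | SA i => [:: (5 + i, false)]
  | SB i => [:: (4, true); (5 + i, true); (4, false)]
  | ST => [:: (4, false)]
  | SD k => (4, true) :: marker_pair k
  end.

Definition solution_block (is_ : seq nat) :=
  map SA is_ ++ ST :: map SB (rev is_).

(** * The component that records indices *)

Section IndexComponent.
Notation word := (concat_words index_word).

Lemma concat_words_cat (wd : step -> seq (nat * bool)) es1 es2 :
  concat_words wd (es1 ++ es2) = concat_words wd es1 ++ concat_words wd es2.
Proof. by rewrite /concat_words map_cat flatten_cat. Qed.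

Lemma index_word_marked s :
  if step_marker s is Some k then
    index_word s = [:: (4, true)] ++ [:: ((k + 3) %% 4, true), (nat_of_ord k, false) & [::]]
  else unmarked (index_word s).
Proof. by case: s => //= i; rewrite /is_marker /= ltnNge. Qed.

Lemma index_height W : all (fun s => step_marker s == None) W ->
  height 4 (word W) = count is_T W.
Proof.
elim: W => //= s W IHW /andP[ms /IHW]; rewrite /concat_words /= height_cat => ->.
by case: s ms => //= i _; rewrite /letter_height /=; lia.
Qed.

(** B_i begins with t^-1, so its s-letter lies one level below the current height. *)
Definition lifted_index h s : seq ((int * nat) * bool) :=
  match s with
  | SA i => [:: ((h, 5 + i), false)]
  | SB i => [:: ((h - 1, 5 + i), true)]%R
  | _ => [::]
  end.

Lemma hlift_index h W : all is_AB W ->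
  hlift 4 h (word W) = flatten [seq lifted_index h s | s <- W].
Proof.
elim: W => //= s W IHW /andP[ab /IHW]; rewrite /concat_words /= hlift_cat => E.
have -> : (h + height 4 (index_word s) = h)%R.
  by case: s ab => //= i _; rewrite /letter_height /=; lia.
by rewrite {}E; case: s ab.
Qed.

Lemma all_A W : all is_A W -> exists is_, W = map SA is_.
Proof.
elim: W => [|[] //= i W IHW]; first by exists [::].
by move=> /IHW[is_ ->]; exists (i :: is_).
Qed.

Lemma all_B W : all is_B W -> exists is_, W = map SB is_.
Proof.
elim: W => [|[] //= i W IHW]; first by exists [::].
by move=> /IHW[is_ ->]; exists (i :: is_).
Qed.

Definition closings_at (g : int) :=
  count (fun x : (int * nat) * bool => (x.1.1 == g) && x.2).
Definition openings_at (g : int) :=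
  count (fun x : (int * nat) * bool => (x.1.1 == g) && ~~ x.2).

Lemma closings_at_lifted g h W : all is_AB W ->
  closings_at g (flatten [seq lifted_index h s | s <- W]) =
  ((h - 1)%R == g) * count is_B W.
Proof.
rewrite /closings_at; elim: W => [|s W IHW] /=; first by rewrite muln0.
case/andP=> abs /IHW IH; rewrite count_cat IH.
by case: s abs => //= i _; rewrite ?andbF ?andbT ?addn0 ?mulnDr ?muln1.
Qed.

Lemma openings_at_lifted g h W : all is_AB W ->
  openings_at g (flatten [seq lifted_index h s | s <- W]) =
  (h == g) * count is_A W.
Proof.
rewrite /openings_at; elim: W => [|s W IHW] /=; first by rewrite muln0.
case/andP=> abs /IHW IH; rewrite count_cat IH.
by case: s abs => //= i _; rewrite ?andbF ?andbT ?addn0 ?mulnDr ?muln1.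
Qed.

Lemma all_AB_no_T W : all (fun s => step_marker s == None) W ->
  count is_T W = 0 -> all is_AB W.
Proof.
elim: W => //= s W IHW /andP[ms mW] /eqP; rewrite addn_eq0 => /andP[ts /eqP tW].
by rewrite IHW // andbT; case: s ms ts.
Qed.

Lemma all_A_no_B W : all is_AB W -> count is_B W = 0 -> all is_A W.
Proof.
elim: W => //= s W IHW /andP[ms mW] /eqP; rewrite addn_eq0 => /andP[ts /eqP tW].
by rewrite IHW // andbT; case: s ms ts.
Qed.

Lemma all_B_no_A W : all is_AB W -> count is_A W = 0 -> all is_B W.
Proof.
elim: W => //= s W IHW /andP[ms mW] /eqP; rewrite addn_eq0 => /andP[ts /eqP tW].
by rewrite IHW // andbT; case: s ms ts.
Qed.

Lemma one_T W : all (fun s => step_marker s == None) W -> count is_T W = 1 ->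
  exists W1 W2, [/\ W = W1 ++ ST :: W2, all is_AB W1 & all is_AB W2].
Proof.
elim: W => //= s W IHW /andP[ms mW]; case: s ms => //= [i _|i _|_].
- by rewrite add0n => /(IHW mW)[W1 [W2 [-> ? ?]]]; exists (SA i :: W1), W2.
- by rewrite add0n => /(IHW mW)[W1 [W2 [-> ? ?]]]; exists (SB i :: W1), W2.
- by move=> [/(all_AB_no_T mW) aW]; exists [::], W.
Qed.

(** Height 0 excludes T. Then all A's write positive letters at height 0 and all B's negative
    letters at height -1, so nothing can cancel. *)
Lemma index_dyck_nil W : all (fun s => step_marker s == None) W ->
  dyck (word W) -> W = [::].
Proof.
move=> mW dW; have := dyck_height 4 dW; rewrite index_height // => -[t0].
have aW := all_AB_no_T mW t0.
have := dyck_hlift 4 0%R dW; rewrite hlift_index // => dl.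
have C g : closings_at g _ = openings_at g _ := dyck_count (fun x => x.1 == g) dl.
have := C 0%R; have := C (-1)%R.
rewrite !closings_at_lifted // !openings_at_lifted //= !mul0n !mul1n => B0 A0.
by case: W aW B0 A0 {mW dW t0 dl C} => //= -[].
Qed.

(** The height forces exactly one T. Before it, B's alone write at height -1; after it, A's alone
    write at height 1; so both are absent. What remains at height 0 is a positive word followed by a
    negative one, and their cancellation makes the two index sequences mutually reverse. *)
Lemma index_dyck_block W : all (fun s => step_marker s == None) W ->
  dyck (word W ++ [:: (4, true)]) -> exists is_, W = solution_block is_.
Proof.
move=> mW dW; have := dyck_height 4 dW; rewrite height_cat index_height // => t1.
have {t1} /(one_T mW)[W1 [W2 [EW a1 a2]]] : count is_T W = 1.
  by move: t1; rewrite /= /letter_height /=; lia.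
have := dyck_hlift 4 0%R dW.
rewrite {}EW concat_words_cat {2}/concat_words /= -/(concat_words _ _) -catA.
have T1 : all (fun s => step_marker s == None) W1 /\ count is_T W1 = 0.
  by elim: W1 a1 => //= s W1 IH /andP[+ /IH[-> ->]]; case: s.
rewrite hlift_cat index_height; last by case: T1.
rewrite T1.2 /= /letter_height /= hlift_cat /= !hlift_index // cats0 !GRing.add0r.
set l1 := flatten _; set l2 := flatten _ => dl.
have C g := dyck_count (fun x => x.1 == g) dl.
have {}C g : closings_at g l1 + closings_at g l2 = openings_at g l1 + openings_at g l2.
  by have := C g; rewrite !count_cat.
have := C 1%R; have := C (-1)%R.
rewrite !closings_at_lifted // !openings_at_lifted //= !mul0n !mul1n !addn0.
move=> /(all_A_no_B a1)/all_A[is_ Ei] /esym/(all_B_no_A a2)/all_B[js Ej].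
exists is_; rewrite /solution_block Ei Ej; suff -> : is_ = rev js by rewrite revK.
have E1 : l1 = posw [seq (0%R, 5 + i) | i <- is_].
  by rewrite /l1 Ei; elim: (is_) => //= i r ->.
have E2 : l2 = inv_word (posw [seq (0%R, 5 + i) | i <- rev js]).
  rewrite /inv_word /posw -!map_comp -map_rev revK /l2 Ej.
  by elim: (js) => //= i r ->.
move: dl; rewrite E1 E2 => /dyck_pos_inv; apply: inj_map => i j [].
by move/addnI.
Qed.

Lemma solution_block_dyck is_ : dyck (word (solution_block is_) ++ [:: (4, true)]).
Proof.
elim: is_ => [|i is_ IH]; first exact: (dyck_cons (4, false)) (dyck_nil _) (dyck_nil _).
rewrite /solution_block rev_cons map_rcons -cats1.
(* The t^-1 that opens the last B_i closes the inner block, and its final t cancels the t^-1 that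
   follows. *)
have -> : word (map SA (i :: is_) ++ ST :: map SB (rev is_) ++ [:: SB i]) ++ [:: (4, true)]
  = (5 + i, false) :: (word (solution_block is_) ++ [:: (4, true)]) ++
    (5 + i, true) :: [:: (4, false); (4, true)].
  rewrite -cat_cons catA concat_words_cat /solution_block.
  by rewrite [word (map SA (i :: _) ++ _)]/concat_words /= -!catA.
apply: (dyck_cons (5 + i, false) IH).
exact: (dyck_cons (4, false)) (dyck_nil _) (dyck_nil _).
Qed.
End IndexComponent.

(** * The component that compares words *)

Section WordComponent.
Variables (u v : nat -> seq bool) (l : nat).

Definition bits_word (s : seq bool) : seq (nat * bool) :=
  posw [seq 4 + nat_of_bool b | b <- s].

Definition value_word s : seq (nat * bool) :=
  match s with
  | SA i => bits_word (u i)
  | SB i => inv_word (bits_word (v i))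
  | ST => bits_word (u l) ++ inv_word (bits_word (v l))
  | SD k => inv_word (bits_word (v 0)) ++ marker_pair k ++ bits_word (u 0)
  end.
Notation word := (concat_words value_word).

Lemma bits_word_cat s t : bits_word (s ++ t) = bits_word s ++ bits_word t.
Proof. by rewrite /bits_word map_cat /posw map_cat. Qed.

Lemma bits_word_unmarked s : unmarked (bits_word s).
Proof. by rewrite /bits_word /posw -map_comp all_map; apply/allP => -[]. Qed.

Lemma inv_word_unmarked w : unmarked (inv_word w) = unmarked w.
Proof. by rewrite /inv_word all_rev all_map; apply: eq_all => -[]. Qed.

Lemma inv_word_cat (E : eqType) (w1 w2 : seq (E * bool)) :
  inv_word (w1 ++ w2) = inv_word w2 ++ inv_word w1.
Proof. by rewrite /inv_word map_cat rev_cat. Qed.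

Lemma value_word_marked s :
  if step_marker s is Some k then
    value_word s = inv_word (bits_word (v 0)) ++
      [:: ((k + 3) %% 4, true), (nat_of_ord k, false) & bits_word (u 0)]
  else unmarked (value_word s).
Proof. by case: s => //= *; rewrite ?all_cat ?inv_word_unmarked ?bits_word_unmarked. Qed.

Lemma value_solution_block is_ :
  bits_word (u 0) ++ word (solution_block is_) ++ inv_word (bits_word (v 0)) =
  bits_word (u 0 ++ flatten [seq u i | i <- is_] ++ u l) ++
  inv_word (bits_word (v 0 ++ flatten [seq v i | i <- is_] ++ v l)).
Proof.
have A : word (map SA is_) = bits_word (flatten [seq u i | i <- is_]).
  by elim: is_ => //= i r; rewrite bits_word_cat => <-.
have B : word (map SB (rev is_)) = inv_word (bits_word (flatten [seq v i | i <- is_])).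
  elim: is_ {A} => //= i r; rewrite rev_cons map_rcons -cats1 concat_words_cat.
  by rewrite bits_word_cat inv_word_cat => ->; rewrite /concat_words /= cats0.
rewrite /solution_block concat_words_cat A -cat1s concat_words_cat B.
by rewrite {1}/concat_words /= cats0 !bits_word_cat !inv_word_cat !catA.
Qed.

Lemma bits_word_dyck_inv s t : dyck (bits_word s ++ inv_word (bits_word t)) -> s = t.
Proof. by move=> /dyck_pos_inv; apply: inj_map => -[] []. Qed.
End WordComponent.

(** * Solutions versus trivial products of steps *)

Lemma take_find_marker (es : seq step) :
  all (fun s => step_marker s == None) (take (find (fun s => step_marker s) es) es).
Proof. by elim: es => //= s es IH; case E: (step_marker s) => //=; rewrite E. Qed.

Lemma steps_sound u v l es : es <> [::] -> all (step_ok l) es ->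
  dyck (concat_words (value_word u v l) es) -> dyck (concat_words index_word es) ->
  exists is_, all (fun i => 0 < i < l) is_ /\
    u 0 ++ flatten [seq u i | i <- is_] ++ u l =
    v 0 ++ flatten [seq v i | i <- is_] ++ v l.
Proof.
move=> es0 ok_es d1 d2.
case: (boolP (has (fun s => step_marker s) es)) => mes; last first.
  case: es0; apply: index_dyck_nil d2; move: mes; rewrite -all_predC.
  by apply: sub_all => -[].
have u0 := bits_word_unmarked (u 0).
have v0 : unmarked (inv_word (bits_word (v 0))).
  by rewrite inv_word_unmarked bits_word_unmarked.
(* In each component more than half of the D's open a gap, hence some D opens one in both. *)
have G1 := dyck_step_gaps v0 u0 (value_word_marked u v l) mes d1.
have G2 := dyck_step_gaps (pre := [:: (4, true)]) (post := [::]) isT isT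
  index_word_marked mes d2.
have [|es1 [s [r [k [Ees _ g1 g2]]]]] := @common_gap _ step_marker
  (value_word u v l) index_word (bits_word (u 0)) [::] es; first by lia.
have b1 := gap_block v0 u0 (value_word_marked u v l) (ltn_ord k) g1.
have b2 := gap_block (pre := [:: (4, true)]) (post := [::]) isT isT
  index_word_marked (ltn_ord k) g2.
(* The index component gives the steps up to the next D the shape of a block; [b1] then states that
   the words of this block agree. *)
have [is_ Ei] := index_dyck_block (take_find_marker r) b2.
exists is_; rewrite Ei value_solution_block in b1; split; last exact: bits_word_dyck_inv b1.
have : all (step_ok l) (take (find (fun s => step_marker s) r) r).
  move: ok_es; rewrite Ees all_cat /= => /and3P[_ _].
  by rewrite -{1}[r](cat_take_drop (find (fun s => step_marker s) r)) all_cat => /andP[].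
rewrite Ei /solution_block all_cat => /andP[+ _].
by rewrite all_map; apply: sub_all.
Qed.

Definition solution_steps is_ :=
  flatten [seq SD k :: solution_block is_ | k <- enum 'I_4].

Lemma enum_I4 : enum 'I_4 = [:: inord 0; inord 1; inord 2; inord 3].
Proof.
by apply: (inj_map val_inj); rewrite val_enum_ord /= !inordK.
Qed.

(** With X = post W pre, the product is pre x_3^-1 (x_0 X x_0^-1) (x_1 X x_1^-1) (x_2 X x_2^-1) x_3
    post W. *)
Lemma solution_steps_dyck wd pre post is_ :
  (forall k, wd (SD k) = pre ++ marker_pair k ++ post) ->
  dyck (post ++ concat_words wd (solution_block is_) ++ pre) ->
  dyck (concat_words wd (solution_steps is_)).
Proof.
move=> wdD; set W := solution_block is_; set X := post ++ _ => dX.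
have dx k : dyck ((k, false) :: X ++ [:: (k, true)]) by apply: dyck_conj.
have -> : concat_words wd (solution_steps is_) = pre ++
   ((3, true) :: (((0, false) :: X ++ [:: (0, true)]) ++
   ((1, false) :: X ++ [:: (1, true)]) ++ ((2, false) :: X ++ [:: (2, true)])) ++
   [:: (3, false)]) ++ post ++ concat_words wd W.
  have -> : concat_words wd (solution_steps is_) = flatten
      [seq (pre ++ marker_pair k ++ post) ++ concat_words wd W | k <- enum 'I_4].
    rewrite /solution_steps -/W; elim: (enum 'I_4) => //= k r <-.
    by rewrite -wdD /concat_words /= map_cat flatten_cat catA.
  rewrite enum_I4 /X /marker_pair /= !inordK //= cats0.
  by do !rewrite -!catA /=.
(* Rotating the leading [pre] to the end completes the last copy of X. *)
apply/trivial_word_dyck/trivial_rot/dyck_trivial.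
rewrite -[(_ ++ _) ++ pre]catA -[(post ++ _) ++ pre]catA -/X; apply: dyck_cat dX.
apply: (dyck_cons (3, true)) (dyck_nil _).
by do !apply: dyck_cat.
Qed.

(** * The ICP instance *)

(** Reducing a word does not change its action; this allows the instance to store reduced words. *)
Lemma foldr_act_idem (E : eqType) (w s : seq (E * bool)) : is_reduced s ->
  foldr (@act E) s (foldr (@act E) [::] w) = foldr (@act E) s w.
Proof.
move=> rs; elim: w => //= x w <-.
case: (foldr _ [::] w) => //= y r; case: eqP => //= ->.
by rewrite actK //; apply: foldr_act_reduced.
Qed.

Lemma freduce_flatten ws : freduce (flatten (map freduce ws)) = freduce (flatten ws).
Proof.
rewrite !freduceE; elim: ws => //= w ws IH.
rewrite [freduce w]freduceE !foldr_cat foldr_act_idem ?IH //; exact: foldr_act_reduced.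
Qed.

Lemma freduce_nilP w : freduce w = [::] <-> dyck w.
Proof.
split=> [w0|/dyck_trivial tw]; last exact: tw.
by have := dyck_over_foldr w; rewrite -freduceE w0.
Qed.

Lemma embw_dyckP w : dyck (embw w) <-> dyck w.
Proof. by split; [apply: embw_dyck | apply: dyck_embw]. Qed.

Definition step_code s : nat + nat + option 'I_4 :=
  match s with
  | SA i => inl (inl i) | SB i => inl (inr i) | ST => inr None | SD k => inr (Some k)
  end.
Definition step_decode c :=
  match c with
  | inl (inl i) => SA i | inl (inr i) => SB i | inr None => ST | inr (Some k) => SD k
  end.
Lemma step_codeK : cancel step_code step_decode. Proof. by case. Qed.
HB.instance Definition _ := Equality.copy step (can_type step_codeK).

Section Instance.
Variables (n : nat) (n3 : 3 <= n).

(* The copies of [ST] only pad the list to the required length. *)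
Definition instance_steps : seq step :=
  map SA (iota 1 (n - 2)) ++ map SB (iota 1 (n - 2)) ++ map SD (enum 'I_4) ++
  nseq (6 * (n - 2) + 4) ST.

Lemma size_instance_steps : size instance_steps = 8 * (n - 1).
Proof. rewrite !size_cat size_map size_map size_map !size_iota size_nseq size_enum_ord; lia. Qed.

(** The solvability argument sees the list only through its members, so the order and the
    repetitions of [ST] are harmless. *)
Lemma mem_instance_steps s : (s \in instance_steps) = step_ok n.-1 s.
Proof.
have mapP_inj (c : nat -> step) (i : nat) : injective c ->
    (c i \in map c (iota 1 (n - 2))) = (0 < i < n.-1).
  by move=> ic; rewrite mem_map // mem_iota; lia.
have notin (T : Type) (c : T -> step) (r : seq T) : (forall x, c x != s) -> (s \in map c r) = false.
  by move=> cs; elim: r => //= x r; rewrite inE eq_sym (negbTE (cs x)).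
rewrite !mem_cat mem_nseq; case: s notin => [i|i||k] notin.
- rewrite mapP_inj; last by move=> x y [].
  by rewrite !notin // andbF !orbF.
- rewrite (@mapP_inj SB); last by move=> x y [].
  by rewrite !notin // andbF !orbF.
- by rewrite eqxx andbT addnS !orbT.
- rewrite (mem_map (f := SD)); last by move=> x y [].
  by rewrite mem_enum !orbT.
Qed.

Variable P : pcp_instance.
Let u i := (nth ([::], [::]) P i).1.
Let v i := (nth ([::], [::]) P i).2.
Let l := n.-1.

Definition encode_step s : fword * fword :=
  (freduce (embw (value_word u v l s)), freduce (embw (index_word s))).
Definition icp_of : icp_instance := map encode_step instance_steps.

Lemma icp_of_freduced :
  all (fun p => freduced p.1 && freduced p.2) icp_of.
Proof.
rewrite all_map; apply/allP => s _ /=.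
by rewrite !freduced_is_reduced !freduceE !foldr_act_reduced.
Qed.

Lemma freduce_embw (wd : step -> seq (nat * bool)) es :
  freduce (flatten [seq freduce (embw (wd s)) | s <- es]) = [::] <->
  dyck (concat_words wd es).
Proof.
rewrite -embw_dyckP -freduce_nilP.
rewrite -[map _ es]/(map (freduce \o (embw \o wd)) es) map_comp freduce_flatten.
suff -> : embw (concat_words wd es) = flatten (map (embw \o wd) es) by [].
by rewrite /concat_words; elim: es => //= s es <-; rewrite embw_cat.
Qed.

Lemma icp_of_solvable : ICP_solvable icp_of <->
  exists es, [/\ es <> [::], all (step_ok l) es,
    dyck (concat_words (value_word u v l) es) & dyck (concat_words index_word es)].
Proof.
have nthE ls : all (fun j => j < size icp_of) ls ->
    [seq nth ([::], [::]) icp_of j | j <- ls] =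
    map encode_step [seq nth ST instance_steps j | j <- ls].
  move=> /allP ok; rewrite -map_comp; apply/eq_in_map => j /ok.
  by rewrite size_map => jl /=; rewrite (nth_map ST).
split=> [[ls [ls0 [ok [e1 e2]]]]|[es [es0 ok d1 d2]]].
  exists [seq nth ST instance_steps j | j <- ls]; split.
  - by case: ls ls0 {ok e1 e2}.
  - rewrite all_map; apply: sub_all ok => j; rewrite size_map => jl /=.
    by rewrite -mem_instance_steps mem_nth.
  - apply/freduce_embw; rewrite -[RHS]e1.
    rewrite (map_comp fst (nth ([::], [::]) icp_of)) nthE //.
    by rewrite -[map fst _]map_comp.
  - apply/freduce_embw; rewrite -[RHS]e2.
    rewrite (map_comp snd (nth ([::], [::]) icp_of)) nthE //.
    by rewrite -[map snd _]map_comp.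
(* Each step is represented by its first position in the list. *)
pose ls := [seq index s instance_steps | s <- es].
have okls : all (fun j => j < size icp_of) ls.
  rewrite all_map; apply: sub_all ok => s oks /=.
  by rewrite size_map index_mem mem_instance_steps.
have Ees : [seq nth ST instance_steps j | j <- ls] = es.
  rewrite -map_comp map_id_in // => s /(allP ok); rewrite -mem_instance_steps.
  exact: nth_index.
exists ls; split; first by rewrite /ls; case: (es) es0.
split=> //; split.
  rewrite (map_comp fst (nth ([::], [::]) icp_of)) nthE // Ees -map_comp.
  exact/freduce_embw.
rewrite (map_comp snd (nth ([::], [::]) icp_of)) nthE // Ees -map_comp.
exact/freduce_embw.
Qed.

Lemma icp_of_correct : size P = n -> RPCP n P <-> ICP (8 * (n - 1)) icp_of.
Proof.
move=> sP; split=> [[_ [is_ [ok E]]]|[_ [_ /icp_of_solvable[es [es0 ok d1 d2]]]]].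
  split; first by rewrite size_map size_instance_steps.
  split; first exact: icp_of_freduced.
  rewrite sP in ok E; apply/icp_of_solvable.
  exists (solution_steps is_); split.
  - by rewrite /solution_steps enum_I4.
  - rewrite /solution_steps; elim: (enum _) => //= k r IH.
    rewrite all_cat IH andbT /solution_block all_cat /= !all_map all_rev.
    by rewrite (sub_all _ ok) // (sub_all _ ok).
  - apply: (solution_steps_dyck (pre := inv_word (bits_word (v 0)))
      (post := bits_word (u 0))) => //.
    by rewrite value_solution_block E; apply: dyck_inv_refl.
  - apply: (solution_steps_dyck (pre := [:: (4, true)]) (post := [::])).
      by move=> k; rewrite cats0.
    exact: solution_block_dyck.
split=> //; have [is_ [oki E]] := steps_sound es0 ok d1 d2.
by exists is_; rewrite sP.
Qed.
End Instance.

(** * Computability of the reduction *)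

(** The list [r] is fixed and only its entries depend on the input, so the fold is unrolled into a
    composition. *)
Lemma computable_const_list (T : Type) (f : T -> nat -> nat) (r : seq T) :
  (forall t, computable1 (f t)) ->
  computable1 (fun x => foldr (fun t s => ccons (f t x) s) 0 r).
Proof.
move=> fP; elim: r => [|t r IHr] /=; first exact: computable_const.
exact: (computable_comp2 computable_cons).
Qed.

(** The letter is a fixed parameter, so its code enters as a constant; [0] codes the empty word. *)
Definition cact (x : letter) c :=
  if c == 0 then ccons (pickle x) 0
  else if chead c == pickle (linv x) then ctail c else ccons (pickle x) c.
Definition cactw (w : fword) c := foldr cact c w.

Lemma cactE x (s : fword) : cact x (pickle s) = pickle (act x s).
Proof.
case: s => [|y r] //; rewrite /cact -[pickle (y :: r)]/(ccons (pickle y) (pickle r)).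
rewrite -[_ == 0]negbK -lt0n (leq_trans _ (ltn_ccons _ _)) //= cheadK ctailK.
by rewrite (inj_eq (pcan_inj pickleK)); case: eqP.
Qed.

Lemma cactwE w (s : fword) : cactw w (pickle s) = pickle (foldr (@act bool) s w).
Proof. by elim: w => //= x w ->; rewrite cactE. Qed.

Lemma computable_act x : computable1 (cact x).
Proof.
apply: (computable_if (b := fun v => nth 0 v 0 == 0)).
- by apply: (computable_comp2 (f := fun x y => x == y) computable_eq);
    [comp_nth | apply: computable_const].
- exact: computable_const.
apply: (computable_if (b := fun v => chead (nth 0 v 0) == pickle (linv x))).
- by apply: (computable_comp2 (f := fun x y => x == y) computable_eq);
    [apply: computable_head | apply: computable_const].
- exact: computable_tail.
apply: (computable_comp2 computable_cons); [exact: computable_const | comp_nth].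
Qed.

Lemma computable_actw w : computable1 (cactw w).
Proof.
elim: w => [|x w IHw] /=; first comp_nth.
exact: (computable_comp1 (computable_act x)).
Qed.

(** Reading every nonzero entry as [true] makes the decoding total. *)
Definition bits m := [seq b != 0 | b <- CodeSeq.decode m].
Definition cbits := cfoldr (fun b s => ccons (b != 0) s) 0.
Definition cbit sg b c :=
  if b == 0 then cactw (emb (4, sg)) c else cactw (emb (5, sg)) c.
Arguments cbit : simpl never.
Definition cpos := cfoldr (cbit false).
(** Inversion reverses the word, so prepending the inverse letters one by one reads it from the
    left. *)
Definition cneg := cfoldl (fun c b => cbit true b c).

Lemma cbitE sg b (s : fword) :
  cbit sg b (pickle s) = pickle (foldr (@act bool) s (emb (4 + (b != 0), sg))).
Proof. by rewrite /cbit !cactwE; case: eqP. Qed.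

Lemma bitsK (s : seq bool) : bits (pickle s) = s.
Proof. by rewrite /bits CodeSeq.codeK -map_comp map_id_in // => -[]. Qed.

Lemma cbitsE m : cbits m = pickle (bits m).
Proof.
rewrite /cbits /bits -{1}[m]CodeSeq.decodeK cfoldrE.
by elim: (CodeSeq.decode m) => //= b s ->.
Qed.

Lemma cposE (s : fword) m :
  cpos (pickle s) m = pickle (foldr (@act bool) s (embw (bits_word (bits m)))).
Proof.
rewrite /cpos /bits -{1}[m]CodeSeq.decodeK cfoldrE.
elim: (CodeSeq.decode m) => //= b r ->.
rewrite cbitE -foldr_cat.
by [].
Qed.

Lemma cnegE (s : fword) m :
  cneg (pickle s) m = pickle (foldr (@act bool) s (embw (inv_word (bits_word (bits m))))).
Proof.
rewrite /cneg /bits -{1}[m]CodeSeq.decodeK cfoldlE.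
elim: (CodeSeq.decode m) s => //= b r IHr s.
rewrite cbitE IHr -foldr_cat; congr (pickle (foldr _ _ _)).
by rewrite /inv_word /= rev_cons -cats1 embw_cat {3}/embw /= cats0.
Qed.

Lemma computable_is0 k a : computable k a -> computable k (fun v => a v == 0).
Proof.
move=> aP; apply: (computable_comp2 (f := fun x y => x == y) computable_eq) aP _.
exact: computable_const.
Qed.

Lemma computable_bit sg : computable2 (cbit sg).
Proof.
apply: (computable_if (b := fun v => nth 0 v 0 == 0)).
- by apply: computable_is0; comp_nth.
- by apply: (computable_comp1 (computable_actw _)); comp_nth.
- by apply: (computable_comp1 (computable_actw _)); comp_nth.
Qed.

Lemma computable_pos : computable2 cpos.
Proof. exact: computable_foldr (computable_bit false). Qed.

Lemma computable_neg : computable2 cneg.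
Proof.
by apply: computable_foldl; apply: (computable_comp2 (computable_bit true)); comp_nth.
Qed.

Lemma computable_bits : computable1 cbits.
Proof.
apply: (@computable_comp2 1 (cfoldr (fun b s => ccons (b != 0) s))
  (fun=> 0) (nth 0 ^~ 0)); [|exact: computable_const|comp_nth].
apply: computable_foldr; apply: (computable_comp2 computable_cons); last comp_nth.
apply: (@eq_computable _ (fun v => if nth 0 v 0 == 0 then 0 else 1)).
  by move=> v; case: eqP.
apply: (computable_if (b := fun v => nth 0 v 0 == 0)); try exact: computable_const.
by apply: computable_is0; comp_nth.
Qed.

Definition centry i x := chead (iter i ctail x).
Definition cfst i x := chead (centry i x).
Definition csnd i x := chead (ctail (centry i x)).

Lemma computable_entry i : computable1 (centry i).
Proof.
apply: (computable_comp1 computable_head).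
elim: i => [|i IHi] /=; first comp_nth.
exact: (computable_comp1 computable_tail).
Qed.

Lemma computable_fst i : computable1 (cfst i).
Proof. exact: (computable_comp1 computable_head (computable_entry i)). Qed.

Lemma computable_snd i : computable1 (csnd i).
Proof.
apply: (computable_comp1 computable_head).
exact: (computable_comp1 computable_tail (computable_entry i)).
Qed.

Lemma centryE (P : pcp_instance) i : i < size P ->
  centry i (pickle P) = pickle (nth ([::], [::]) P i).
Proof.
rewrite /centry; elim: i P => [|i IHi] [|p P] // iP.
  by rewrite /= -[pickle (p :: P)]/(ccons (pickle p) (pickle P)) cheadK.
by rewrite iterSr -[pickle (p :: P)]/(ccons (pickle p) (pickle P)) ctailK IHi.
Qed.

Lemma pickle_pair (T U : countType) (p : T * U) :
  pickle p = ccons (pickle p.1) (ccons (pickle p.2) 0).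
Proof. by []. Qed.

Section Reduction.
Variables (n : nat) (n3 : 3 <= n).
Let l := n.-1.

(** A total reading of numbers as instances of size [n], inverse to [pickle] on those instances
    ([pcp_ofK]). *)
Definition pcp_of x : pcp_instance :=
  [seq (bits (cfst i x), bits (csnd i x)) | i <- iota 0 n].

Lemma size_pcp_of x : size (pcp_of x) = n.
Proof. by rewrite size_map size_iota. Qed.

Lemma nth_pcp_of x i : i < n ->
  nth ([::], [::]) (pcp_of x) i = (bits (cfst i x), bits (csnd i x)).
Proof.
by move=> iN; rewrite (nth_map 0) ?size_iota // nth_iota.
Qed.

Lemma pcp_ofK (P : pcp_instance) : size P = n -> pcp_of (pickle P) = P.
Proof.
move=> sP; apply: (@eq_from_nth _ ([::], [::])); first by rewrite size_pcp_of.
rewrite size_pcp_of => i iN; rewrite nth_pcp_of // /cfst /csnd centryE ?sP //.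
by rewrite pickle_pair ctailK !cheadK !bitsK; case: nth.
Qed.

Definition crebuild x :=
  foldr (fun i s => ccons (ccons (cbits (cfst i x)) (ccons (cbits (csnd i x)) 0)) s)
    0 (iota 0 n).

Lemma crebuildE x : crebuild x = pickle (pcp_of x).
Proof.
rewrite /crebuild /pcp_of; elim: (iota 0 n) => //= i r ->.
by rewrite !cbitsE.
Qed.

Lemma computable_rebuild : computable1 crebuild.
Proof.
apply: (computable_const_list
  (f := fun i x => ccons (cbits (cfst i x)) (ccons (cbits (csnd i x)) 0))) => i.
apply: (computable_comp2 computable_cons).
  exact: (computable_comp1 computable_bits (computable_fst i)).
apply: (computable_comp2 computable_cons); last exact: computable_const.
exact: (computable_comp1 computable_bits (computable_snd i)).
Qed.

Let cnil := pickle ([::] : fword).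
(** Each product is built from right to left, its last factor acting first on the empty word; the
    results are therefore already reduced. *)
Definition cvalue s x :=
  match s with
  | SA i => cpos cnil (cfst i x)
  | SB i => cneg cnil (csnd i x)
  | ST => cpos (cneg cnil (csnd l x)) (cfst l x)
  | SD k => cneg (cactw (embw (marker_pair k)) (cpos cnil (cfst 0 x))) (csnd 0 x)
  end.

Lemma computable_value s : computable1 (cvalue s).
Proof.
have pP i : computable1 (fun x => cpos cnil (cfst i x)).
  apply: (computable_comp2 computable_pos); first exact: computable_const.
  exact: computable_fst.
have nP i : computable1 (fun x => cneg cnil (csnd i x)).
  apply: (computable_comp2 computable_neg); first exact: computable_const.
  exact: computable_snd.
case: s => [i|i||k] /=; [exact: pP | exact: nP | | ].
  exact: (computable_comp2 computable_pos (nP l) (computable_fst l)).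
apply: (computable_comp2 computable_neg _ (computable_snd 0)).
exact: (computable_comp1 (computable_actw _) (pP 0)).
Qed.

Lemma cvalueE s x : step_ok l s ->
  cvalue s x = pickle (encode_step n (pcp_of x) s).1.
Proof.
have n0 : 0 < n by apply: leq_trans n3.
have ln : l < n by rewrite /l prednK.
have il i : 0 < i < l -> i < n by case/andP=> _ /ltn_trans; apply.
rewrite /encode_step /= !freduceE.
case: s => [i /il iN|i /il iN|_|k _];
  rewrite /cvalue /value_word !nth_pcp_of //.
- by rewrite cposE.
- by rewrite cnegE.
- by rewrite cnegE cposE embw_cat foldr_cat.
- by rewrite cposE cactwE cnegE !embw_cat !foldr_cat.
Qed.

(** The second words of the pairs do not depend on [x], so their codes are constants. *)
Definition creduce x :=
  foldr (fun s r => ccons (ccons (cvalue s x)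
      (ccons (pickle (freduce (embw (index_word s)))) 0)) r) 0 (instance_steps n).

Lemma computable_reduce : computable1 creduce.
Proof.
apply: (computable_const_list (f := fun s x =>
  ccons (cvalue s x) (ccons (pickle (freduce (embw (index_word s)))) 0))) => s.
apply: (computable_comp2 computable_cons (computable_value s)).
exact: computable_const.
Qed.

Lemma creduceE x : creduce x = pickle (icp_of n (pcp_of x)).
Proof.
rewrite /creduce /icp_of.
have : all (step_ok l) (instance_steps n).
  by apply/allP => s; rewrite mem_instance_steps.
elim: (instance_steps n) => //= s r IHr /andP[oks /IHr ->].
by rewrite cvalueE.
Qed.

(* [x] codes an instance of size [n] exactly when [x = crebuild x]; 0 codes the
   empty list of pairs, which never has the required size. *)
Definition reduction x := if x == crebuild x then creduce x else 0.

Lemma computable_reduction : computable1 reduction.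
Proof.
apply: (computable_if (b := fun v => nth 0 v 0 == crebuild (nth 0 v 0))).
- apply: (computable_comp2 (f := fun x y => x == y) computable_eq); first comp_nth.
  exact: computable_rebuild.
- exact: computable_reduce.
- exact: computable_const.
Qed.

Lemma reduction_correct x :
  (exists P : pcp_instance, pickle P = x /\ RPCP n P) <->
  (exists Pi : icp_instance, pickle Pi = reduction x /\ ICP (8 * (n - 1)) Pi).
Proof.
rewrite /reduction crebuildE creduceE; split=> [[P [<- PP]]|[Pi [EPi PPi]]].
  have sP : size P = n by case: PP.
  rewrite pcp_ofK // eqxx; exists (icp_of n P); split=> //.
  exact/icp_of_correct.
case: eqP EPi => [xE /(pcan_inj pickleK) EPi|_ /(pcan_inj (@pickleK icp_instance) (x2 := [::])) Pi0].
  exists (pcp_of x); split=> //; apply/icp_of_correct; rewrite ?size_pcp_of //.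
  by rewrite -EPi.
case: PPi; rewrite Pi0 /=; lia.
Qed.
End Reduction.

Lemma rec_decidable_comp (A B : nat -> Prop) f :
  computable1 f -> (forall x, A x <-> B (f x)) -> rec_decidable B -> rec_decidable A.
Proof.
move=> [d dP] AB [c cP]; exists (RComp c [:: d]) => x.
have E y : reval c [:: f x] y -> reval (RComp c [:: d]) [:: x] y.
  move=> H; apply: (@ev_comp _ _ _ [:: f x]) H.
  by do !constructor; apply: dP.
have [c1 c0] := cP (f x).
by split=> Ax; apply: E; [apply/c1/AB | apply: c0 => /AB].
Qed.

Theorem mainTheorem4 (n : nat) (hn : 3 <= n) :
  ~ decidable_problem (RPCP n) ->
  ~ decidable_problem (ICP (8 * (n - 1))).
Proof.
move=> undec dec; apply: undec.
exact: rec_decidable_comp (computable_reduction n) (reduction_correct hn) dec.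
Qed.
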